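(* For every $\alpha<1$ there exist constants $\beta,c,C>0$ depending only on $\alpha$ such that the following holds. Let $n$ and $m\ge2$ be positive integers with $n/m>\beta$, and let $(A_{i,t})_{i\in[m]}$ be a simple sticky random walk on $\Delta_n^{m-1}$ with $A_{i,0}\le\alpha n$ for all $i\in[m]$. Let $\tau$ be the absorption time, i.e. the first time at which exactly one coordinate is nonzero. Then $c\,n^2\le\mathbb{E}[\tau]\le C\,n^2$, i.e. the expected absorption time of the simple sticky random walk is $\Theta(n^2)$.
   Context: Write $[m]=\{1,\dots,m\}$. A simple sticky random walk is the random walk on $\Delta_n^{m-1}=\{(x_1,\dots,x_m)\in\mathbb{N}^m:\sum_i x_i=n\}$ ($\mathbb{N}$ includes $0$) whose state at time $t$ is $(A_{i,t})_{i\in[m]}$ and whose transitions are: let $C_t$ be the set of $i$ with $A_{i,t}>0$; choose $j\in C_t$ uniformly; set $A_{j,t+1}=A_{j,t}+|C_t|-1$, $A_{i,t+1}=A_{i,t}-1$ for $i\in C_t\setminus\{j\}$, and $A_{i,t+1}=0$ for $i\notin C_t$. *)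

(* Defs.v *)
From HB Require Import structures.
From mathcomp Require Import all_boot all_order all_algebra.
From mathcomp Require Import all_classical all_reals all_analysis.

Set Implicit Arguments.
Unset Strict Implicit.
Unset Printing Implicit Defensive.

Import Order.TTheory GRing.Theory Num.Theory.

Local Open Scope classical_set_scope.
Local Open Scope ring_scope.

Definition in_simplex (m n : nat) (x : {ffun 'I_m -> nat}) : bool :=
  (\sum_(i < m) x i == n)%N.

Definition active (m : nat) (x : {ffun 'I_m -> nat}) : {set 'I_m} :=
  [set i | (0 < x i)%N]%SET.

(* The subtractions are truncated, but never below zero when j is active. *)
Definition sticky_step (m : nat) (x : {ffun 'I_m -> nat}) (j : 'I_m) :
    {ffun 'I_m -> nat} :=
  [ffun i => if i \in active x then
               if i == j then (x i + #|active x| - 1)%N else (x i - 1)%N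
             else 0%N].

Definition sticky_kernel (R : realType) (m : nat)
    (x y : {ffun 'I_m -> nat}) : R :=
  \sum_(j in active x | sticky_step x j == y) (#|active x|%:R)^-1.

(* A t w i is the value of A_{i,t} at the sample point w.  The initial state
   may be random; the last clause is the Markov property with transition
   probabilities sticky_kernel, written multiplicatively on cylinder events so
   that histories of probability 0 need no special treatment. *)
Definition sticky_walk (R : realType) (d : measure_display)
    (T : measurableType d) (P : probability T R) (m n : nat)
    (A : nat -> T -> {ffun 'I_m -> nat}) : Prop :=
  [/\ forall t w, in_simplex n (A t w),
      forall t x, measurable [set w | A t w = x]
    & forall (t : nat) (x : nat -> {ffun 'I_m -> nat}),
        P [set w | forall k, (k <= t.+1)%N -> A k w = x k] =
        (P [set w | forall k, (k <= t)%N -> A k w = x k]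
           * (sticky_kernel R (x t) (x t.+1))%:E)%E].

Definition absorbed (m : nat) (x : {ffun 'I_m -> nat}) : bool :=
  #|active x| == 1%N.

(* Equal to +oo on sample points where absorption never happens. *)
Definition absorption_time (R : realType) (T : Type) (m : nat)
    (A : nat -> T -> {ffun 'I_m -> nat}) (w : T) : \bar R :=
  ereal_inf [set (t%:R)%:E | t in [set t : nat | absorbed (A t w)]].

(* Main.v *)
Require Import Defs.
From HB Require Import structures.
From mathcomp Require Import all_boot all_order all_algebra.
From mathcomp Require Import all_classical all_reals all_analysis.
From mathcomp Require Import measurable_realfun ring lra zify.

(** While it is nonzero, each coordinate of the walk is a martingale whose
    conditional variance in one step is [k - 1], where [k] is the number of
    nonzero coordinates.  Both bounds come from the drift of a function of the
    state.

    Upper bound.  The drift of [\sum_i x_i ^ 2] is [k (k - 1)], which is at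
    least 2 before absorption, and this sum never exceeds [n ^ 2].  So the
    expected number of steps before absorption is at most [n ^ 2 / 2]
    ([alive_sum_le]).

    Lower bound.  The sum of squares alone says nothing, since its drift is
    unbounded in [k].  A better test function sees only large coordinates:
    with [h = g n], the sum of [max (x_i - h) 0 ^ 2] has drift at most
    [k - 1] per coordinate, and none from the coordinates with
    [x_i + k - 1 <= h].  When [k <= h / 2], which is what a large ratio [n / m]
    ensures, only coordinates above [h / 2] contribute; there are at most
    [2 / g] of them, and the drift is at most [(k - 1) (2 / g)], linear in [k]
    instead of quadratic.  Subtracting [g] times the sum of squares
    makes it [(k - 1) (2 / g - g k)], which is bounded by [4 / g ^ 3] whatever
    [k] is ([potential_drift_le]).  For small [g] this potential still has to
    grow by at least [g n ^ 2] between a start with all coordinates at most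
    [alpha n] and absorption, so the expected number of steps is at least a
    constant times [n ^ 2] ([alive_sum_ge]).

    The drift arguments are carried out on the law of the state at time [t],
    a vector indexed by the finitely many points of the simplex; the Markov
    property on full histories is first reduced to pairs of consecutive times
    ([joint_law]).  Finally the mean absorption time is the sum over [t] of the
    probabilities of not being absorbed at time [t]
    ([integral_absorption_time]). *)

Set Implicit Arguments.
Unset Strict Implicit.
Unset Printing Implicit Defensive.

Import Order.TTheory GRing.Theory Num.Theory.

Local Open Scope classical_set_scope.
Local Open Scope ring_scope.

(** * Drift of coordinatewise functions of the state *)

Section Drift.
Variables (R : realType) (m n : nat).
Implicit Types (x : {ffun 'I_m -> nat}) (f : {ffun 'I_m -> nat} -> R).
Implicit Types (phi : nat -> R).

Definition step_mean f x : R :=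
  #|active x|%:R^-1 * \sum_(j in active x) f (sticky_step x j).

Definition coord_sum phi x : R := \sum_(i < m) phi (x i).

Lemma coord_sum_active phi x :
  phi 0%N = 0 -> coord_sum phi x = \sum_(i in active x) phi (x i).
Proof.
move=> phi0; rewrite /coord_sum [LHS](bigID (mem (active x))) /=.
rewrite [X in _ + X]big1 ?addr0 // => i.
by rewrite inE lt0n negbK => /eqP ->.
Qed.

(** Mean increment of [phi] along one active coordinate of value [a]: it wins
    with probability [1 / k] and moves to [a + k - 1], otherwise it moves to
    [a - 1]. *)
Definition coord_drift (k : nat) phi (a : nat) : R :=
  k%:R^-1 * (phi (a + k - 1)%N + (k%:R - 1) * phi (a - 1)%N) - phi a.

(** By linearity each active coordinate contributes its own mean increment;
    inactive ones stay at 0, where [phi] vanishes. *)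
Lemma step_mean_coord_sum phi x : phi 0%N = 0 -> (0 < #|active x|)%N ->
  step_mean (coord_sum phi) x - coord_sum phi x =
  \sum_(i in active x) coord_drift #|active x| phi (x i).
Proof.
move=> phi0 k0; rewrite big_split/= sumrN -(coord_sum_active _ phi0).
congr (_ - _); rewrite /step_mean -mulr_sumr; congr (_ * _).
rewrite /coord_sum exchange_big /= [LHS](bigID (mem (active x))) /=.
rewrite [X in _ + X]big1 ?addr0; last first.
  by move=> i /negbTE ix; rewrite big1 // => j _; rewrite ffunE ix.
apply: eq_bigr => i ix; rewrite (bigD1 i) //= ffunE ix eqxx; congr (_ + _).
rewrite (eq_bigr (fun=> phi (x i - 1)%N)); last first.
  by move=> j /andP[_ /negbTE ji]; rewrite ffunE ix eq_sym ji.
rewrite sumr_const -[LHS]mulr_natl; congr (_ * _).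
have -> : #|[pred j | (j \in active x) && (j != i)]| = #|active x|.-1.
  rewrite (cardsD1 i (active x)) ix add1n /=.
  by apply: eq_card => j; rewrite !inE andbC.
by rewrite -subn1 natrB.
Qed.

(** This is the variance [((k - 1) ^ 2 + (k - 1)) / k] of the increment of a
    coordinate. *)
Lemma coord_drift_sqr (k a : nat) : (0 < k)%N -> (0 < a)%N ->
  coord_drift k (fun b => b%:R ^+ 2) a = k%:R - 1.
Proof.
move=> k0 a0; rewrite /coord_drift natrB ?addn_gt0 ?a0// natrD natrB//.
have : k%:R != 0 :> R by rewrite pnatr_eq0 -lt0n.
by move=> ?; field.
Qed.

Lemma coord_driftB k phi psi a (g : R) :
  coord_drift k (fun b => phi b - g * psi b) a
  = coord_drift k phi a - g * coord_drift k psi a.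
Proof. by rewrite /coord_drift; ring. Qed.

Definition sqr_excess (h : R) (a : nat) : R := Num.max (a%:R - h) 0 ^+ 2.

(** The function [max u 0 ^ 2] is C^1 with derivative [2 max u 0] and its
    second derivative is at most 2, so it lies below this second order
    expansion. *)
Lemma sqr_max0D (u s : R) :
  Num.max (u + s) 0 ^+ 2 <= Num.max u 0 ^+ 2 + 2 * s * Num.max u 0 + s ^+ 2.
Proof.
case: (lerP u 0) => u0; case: (lerP (u + s) 0) => us0; try nra.
Qed.

(** Up to [h / 2] a coordinate cannot jump over [h] in one step, so it does
    not contribute; above [h / 2] the factor [2 a / h] is at least 1 and the
    bound [k - 1] of [sqr_max0D] suffices.  Writing the bound as a multiple of
    [a] makes it summable over the coordinates, whose total is [n]. *)
Lemma coord_drift_excess (h : R) (k a : nat) : 0 < h ->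
  (0 < k)%N -> (0 < a)%N -> k%:R <= h / 2 ->
  coord_drift k (sqr_excess h) a <= (k%:R - 1) * (2 * a%:R / h).
Proof.
move=> h0 k0 a0 kh.
have k1 : 1 <= k%:R :> R by rewrite (ler_nat _ 1).
have a1 : 1 <= a%:R :> R by rewrite (ler_nat _ 1).
have kn0 : k%:R != 0 :> R by rewrite pnatr_eq0 -lt0n.
have [ah|ah] := lerP a%:R (h / 2).
  have -> : coord_drift k (sqr_excess h) a = 0.
    have z b : (b <= a + k - 1)%N -> sqr_excess h b = 0.
      rewrite -(ler_nat R) natrB ?addn_gt0 ?a0// natrD => ba.
      by rewrite /sqr_excess max_r ?expr0n//; lra.
    by rewrite /coord_drift !z ?mulr0 ?addr0 ?mulr0 ?subr0 //; lia.
  by rewrite mulr_ge0 ?subr_ge0 ?divr_ge0 ?mulr_ge0 ?(ltW h0) ?ler0n.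
have : coord_drift k (sqr_excess h) a <= k%:R - 1.
  rewrite /coord_drift /sqr_excess natrB ?addn_gt0 ?a0// natrD natrB//.
  (* Averaged over the two moves the first order terms cancel, because a
     coordinate is a martingale. *)
  have H1 := sqr_max0D (a%:R - h) (k%:R - 1).
  have H2 := sqr_max0D (a%:R - h) (- 1).
  rewrite lerBlDr ler_pdivrMl ?ltr0n//.
  rewrite (_ : a%:R + k%:R - 1 - h = a%:R - h + (k%:R - 1)); last by ring.
  rewrite (_ : a%:R - 1 - h = a%:R - h + (- 1)); last by ring.
  move: (Num.max (a%:R - h) 0) H1 H2 => u.
  move: (Num.max _ 0 ^+ 2) (Num.max _ 0 ^+ 2) => v w.
  by move=> H1 H2; nra.
move=> /le_trans; apply; rewrite ler_peMr ?subr_ge0//.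
by rewrite ler_pdivlMr//; lra.
Qed.

Definition sqsum : {ffun 'I_m -> nat} -> R := coord_sum (fun a => a%:R ^+ 2).

(** The excess term measures the growth of the dominant coordinates; the
    negative multiple of the sum of squares compensates its drift when many
    coordinates are active. *)
Definition potential (g h : R) : {ffun 'I_m -> nat} -> R :=
  coord_sum (fun a => sqr_excess h a - g * a%:R ^+ 2).

Lemma simplex_sum x : in_simplex n x -> \sum_(i < m) (x i)%:R = n%:R :> R.
Proof. by move=> /eqP <-; rewrite natr_sum. Qed.

Lemma simplex_active x : (0 < n)%N -> in_simplex n x -> (0 < #|active x|)%N.
Proof.
move=> n0 /eqP xn; rewrite lt0n; apply/negP => /eqP/card0_eq x0.
move: n0; rewrite -xn big1// => i _; apply/eqP.
by have := x0 i; rewrite !inE lt0n => /negbT; rewrite negbK.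
Qed.

Lemma sticky_step_simplex x j : in_simplex n x -> j \in active x ->
  in_simplex n (sticky_step x j).
Proof.
move=> /eqP xn jx.
rewrite /in_simplex -(eqn_add2r #|active x|) -[X in (_ + X)%N == _]sum1_card.
rewrite [X in (_ + X)%N == _]big_mkcond -big_split /=.
(* Each active coordinate pays 1, and the winner collects all payments. *)
rewrite (eq_bigr (fun i => x i + if i == j then #|active x| else 0)%N).
  by rewrite big_split /= -big_mkcond big_pred1_eq xn.
move=> i _; rewrite ffunE; have [->|ij] := eqVneq i j.
  by rewrite jx; have := jx; rewrite inE; lia.
by rewrite inE; case: (ltnP 0 (x i)); lia.
Qed.

Lemma sqsum_drift x : (0 < n)%N -> in_simplex n x ->
  step_mean sqsum x - sqsum x = #|active x|%:R * (#|active x|%:R - 1).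
Proof.
move=> n0 xn; rewrite step_mean_coord_sum ?expr0n ?simplex_active//.
under eq_bigr => i ix.
  rewrite coord_drift_sqr ?simplex_active//; last by move: ix; rewrite inE.
  over.
by rewrite sumr_const mulr_natl.
Qed.

Lemma potential_drift (g h : R) x : (0 < n)%N -> in_simplex n x ->
  0 < h -> #|active x|%:R <= h / 2 ->
  step_mean (potential g h) x - potential g h x <=
  (#|active x|%:R - 1) * (2 * n%:R / h - g * #|active x|%:R).
Proof.
move=> n0 xn h0 kh.
have k0 := simplex_active n0 xn.
rewrite step_mean_coord_sum//; last first.
  by rewrite /sqr_excess max_r ?expr0n/= ?mulr0 ?subr0//; lra.
apply: (@le_trans _ _ (\sum_(i in active x)
    ((#|active x|%:R - 1) * (2 * (x i)%:R / h) - g * (#|active x|%:R - 1)))).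
  apply: ler_sum => i ix; rewrite coord_driftB.
  have xi0 : (0 < x i)%N by move: ix; rewrite inE.
  by rewrite coord_drift_sqr// lerB// coord_drift_excess.
rewrite big_split/= sumr_const -mulr_sumr -mulr_suml -mulr_sumr.
rewrite -(coord_sum_active (phi := fun a => a%:R))// /coord_sum simplex_sum//.
rewrite -[(- _) *+ _]mulr_natl.
by rewrite le_eqVlt; apply/orP; left; apply/eqP; ring.
Qed.
End Drift.

(** * Drift and range of the two test functions *)

Section DriftBounds.
Variables (R : realType) (m n : nat).
Implicit Types (x : {ffun 'I_m -> nat}).

Lemma sticky_step_absorbed x j : absorbed x -> j \in active x -> sticky_step x j = x.
Proof.
move=> /eqP x1 jx; apply/ffunP => i; rewrite ffunE x1 addnK.
move/cards1P : (introT eqP x1) => [l al].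
have -> : j = l by move: jx; rewrite al inE => /eqP.
rewrite al inE; case: eqVneq => // il.
by have := al => /setP/(_ i); rewrite !inE (negbTE il) lt0n => /negbFE/eqP.
Qed.

Lemma sqsum_drift_ge x : (0 < n)%N -> in_simplex n x ->
  2 * (~~ absorbed x)%:R <= step_mean (@sqsum R m) x - sqsum R x.
Proof.
move=> n0 xn; rewrite (sqsum_drift R n0 xn) /absorbed.
have := simplex_active n0 xn; case: eqVneq => [-> _|k1 k0].
  by rewrite mulr0 subrr mulr0.
have : 2 <= #|active x|%:R :> R by rewrite ler_nat; lia.
by rewrite mulr1 => ?; nra.
Qed.

(** The factor [(k - 1) (2 / g - g k)] is positive only for [k < 2 / g ^ 2],
    and there it is at most [k (2 / g) <= 4 / g ^ 3].  The hypothesis on [m]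
    bounds the jumps by half of the threshold [g n]. *)
Lemma potential_drift_le (g : R) x : (0 < n)%N -> in_simplex n x ->
  0 < g -> m%:R <= g * n%:R / 2 ->
  step_mean (potential g (g * n%:R)) x - potential g (g * n%:R) x <=
  4 / g ^+ 3 * (~~ absorbed x)%:R.
Proof.
move=> n0 xn g0 mg.
have n0' : 0 < n%:R :> R by rewrite ltr0n.
have km : #|active x|%:R <= m%:R :> R by rewrite ler_nat -[leqRHS]card_ord max_card.
apply: (le_trans (potential_drift _ n0 xn _ _)).
- exact: mulr_gt0.
- exact: le_trans mg.
rewrite /absorbed; have := simplex_active n0 xn; case: eqVneq => [-> _|k1 k0].
  by rewrite subrr mul0r mulr0.
rewrite mulr1.
have {k0} : 1 <= #|active x|%:R :> R by rewrite (ler_nat _ 1).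
rewrite (_ : 2 * n%:R / (g * n%:R) = 2 / g); last by field; rewrite !gt_eqF.
rewrite (_ : 4 / g ^+ 3 = (2 / g) ^+ 2 / g); last by field; rewrite gt_eqF.
have : 0 < 2 / g by rewrite divr_gt0.
move: (2 / g) => q; move: (#|active x|%:R) => k q0 k1'.
rewrite ler_pdivlMr//.
have : 0 <= g * (k - 1) by rewrite mulr_ge0 ?subr_ge0// ltW.
have [qk|qk] := lerP q (g * k); nra.
Qed.

Lemma sqsum_le x (a : R) : (forall i, (x i)%:R <= a) -> in_simplex n x ->
  sqsum R x <= a * n%:R.
Proof.
move=> xa xn; rewrite -(simplex_sum R xn) mulr_sumr.
by apply: ler_sum => i _; rewrite expr2 ler_wpM2r.
Qed.

Lemma simplex_coord_le x i : in_simplex n x -> (x i <= n)%N.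
Proof. by move=> /eqP <-; rewrite (bigD1 i)//= leq_addr. Qed.

Lemma sqsum_le_sqr x : in_simplex n x -> sqsum R x <= n%:R ^+ 2.
Proof.
by move=> xn; apply: sqsum_le => // i; rewrite ler_nat simplex_coord_le.
Qed.

Lemma sqsum_ge0 x : 0 <= sqsum R x.
Proof. by apply: sumr_ge0 => i _; rewrite sqr_ge0. Qed.

Lemma potential_le_sqsum (g h : R) x : 0 <= g -> 0 <= h ->
  potential g h x <= sqsum R x.
Proof.
move=> g0 h0; apply: ler_sum => i _; rewrite /sqr_excess.
have : 0 <= (x i)%:R :> R by [].
move: (x i)%:R => a a0; case: (lerP (a - h) 0) => ah; nra.
Qed.

Lemma potential_ge_sqsum (g h : R) x : - g * sqsum R x <= potential g h x.
Proof.
rewrite /sqsum /coord_sum mulr_sumr; apply: ler_sum => i _.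
by rewrite mulNr lerDr sqr_ge0.
Qed.

Lemma absorbed_coord_sum (phi : nat -> R) x : in_simplex n x -> absorbed x ->
  phi 0%N = 0 -> coord_sum phi x = phi n.
Proof.
move=> /eqP xn /cards1P[l xl] phi0.
have x0 i : i != l -> x i = 0%N.
  move/setP: xl => /(_ i); rewrite !inE lt0n => + /negbTE il.
  by rewrite il => /negbFE/eqP.
rewrite /coord_sum (bigD1 l)//= big1 ?addr0; last by move=> i /x0 ->.
by congr phi; rewrite -xn (bigD1 l)//= big1 ?addn0 // => i /x0 ->.
Qed.

(** On absorbed states the inequality is an equality, the only nonzero
    coordinate being [n]; on the others the crude bound [- g n ^ 2] suffices. *)
Lemma potential_ge (g : R) x : in_simplex n x -> 0 <= g -> g <= 1 ->
  ((1 - g) ^+ 2 - g) * n%:R ^+ 2 - n%:R ^+ 2 * (~~ absorbed x)%:R <=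
  potential g (g * n%:R) x.
Proof.
move=> xn g0 g1; have [xa|xa] := boolP (absorbed x); last first.
  apply: le_trans (potential_ge_sqsum _ _ _).
  have := sqsum_le_sqr xn; have := sqsum_ge0 x.
  move: (sqsum R x) (n%:R ^+ 2) => s N s0 sN; rewrite mulr1.
  have : 0 <= g * (N - s) by rewrite mulr_ge0 ?subr_ge0.
  have N0 : 0 <= N := le_trans s0 sN.
  have : 0 <= N * (g * (1 - g)) by rewrite !mulr_ge0 ?subr_ge0.
  have : 0 <= N * g by rewrite mulr_ge0.
  nra.
rewrite mulr0 subr0 /potential (absorbed_coord_sum xn xa) /sqr_excess; last first.
  by rewrite max_r ?expr0n/= ?mulr0 ?subr0// sub0r oppr_le0 mulr_ge0.
rewrite max_l ?subr_ge0 ?ler_piMl//.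
by rewrite le_eqVlt; apply/orP; left; apply/eqP; ring.
Qed.

End DriftBounds.

(** * Law of the walk at one and two times *)

Section Walk.
Variables (R : realType) (d : measure_display) (T : measurableType d).
Variables (P : probability T R) (m n : nat) (A : nat -> T -> {ffun 'I_m -> nat}).
Hypothesis walkA : sticky_walk P n A.
Implicit Types (x y : {ffun 'I_m -> nat}) (f : {ffun 'I_m -> nat} -> R).

Definition states : seq {ffun 'I_m -> nat} :=
  [seq x <- [seq [ffun i => val (s i)] | s : {ffun 'I_m -> 'I_n.+1}]
  | in_simplex n x].

Lemma states_uniq : uniq states.
Proof.
rewrite filter_uniq// map_inj_uniq ?enum_uniq// => s s' /ffunP ss'.
by apply/ffunP => i; apply: val_inj; have := ss' i; rewrite !ffunE.
Qed.

Lemma mem_states x : (x \in states) = in_simplex n x.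
Proof.
rewrite mem_filter andb_idr// => xn.
apply/mapP; exists [ffun i => inord (x i)]; rewrite ?mem_enum//.
apply/ffunP => i; rewrite !ffunE /= inordK// ltnS.
exact: simplex_coord_le.
Qed.

Lemma walk_state t w : A t w \in states.
Proof. by rewrite mem_states; case: walkA. Qed.

Lemma measurable_state t (p : pred {ffun 'I_m -> nat}) :
  measurable [set w | p (A t w)].
Proof.
rewrite (_ : [set w | _] = \big[setU/set0]_(x <- states | p x) [set w | A t w = x]).
  by apply: bigsetU_measurable => x _; case: walkA.
apply/seteqP; split => w; rewrite -bigcup_seq_cond /=.
  by move=> pw; exists (A t w) => //=; rewrite walk_state.
by move=> [x /= /andP[_ px] ->].
Qed.

(** Real-valued probabilities, so that finite sums can be handled by field
    arithmetic. *)
Definition pr (E : set T) : R := fine (P E).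

Lemma prE (E : set T) : measurable E -> P E = (pr E)%:E.
Proof. by move=> mE; rewrite fineK// fin_num_measure. Qed.

Lemma pr_ge0 (E : set T) : 0 <= pr E.
Proof. exact: fine_ge0. Qed.

Lemma pr_set0 : pr set0 = 0.
Proof. by rewrite /pr measure0. Qed.

Lemma pr_le (E F : set T) : measurable E -> measurable F -> E `<=` F ->
  pr E <= pr F.
Proof.
by move=> mE mF EF; rewrite -lee_fin -!prE// le_measure// inE.
Qed.

Lemma pr_total t (E : set T) : measurable E ->
  pr E = \sum_(x <- states) pr (E `&` [set w | A t w = x]).
Proof.
move=> mE; apply: EFin_inj; rewrite -prE// -sumEFin.
have mEx x : measurable (E `&` [set w | A t w = x]).
  by apply: measurableI => //; case: walkA.
under eq_bigr do rewrite -prE//.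
rewrite (fsbig_seq _ _ states_uniq) -measure_fin_bigcup//=.
- congr (P _); apply/seteqP; split => w /=; last by move=> [x _ []].
  by move=> Ew; exists (A t w) => //=; rewrite walk_state.
- exact: finite_seq.
- by move=> x y _ _ [w [[_ /= <-] [_ /= <-]]].
Qed.

Definition cylinder (s t : nat) (h : nat -> {ffun 'I_m -> nat}) : set T :=
  [set w | forall k, (s <= k <= t)%N -> A k w = h k].

Lemma measurable_cylinder s t h : measurable (cylinder s t h).
Proof.
rewrite (_ : cylinder s t h =
  \bigcap_(k in [set k | (s <= k <= t)%N]) [set w | A k w = h k]).
  by apply: bigcap_measurableType => k _; case: walkA.
by apply/seteqP; split.
Qed.

Lemma cylinderS s t h y : (s <= t)%N ->
  cylinder s.+1 t h `&` [set w | A s w = y] =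
  cylinder s t (fun k => if k == s then y else h k).
Proof.
move=> st; apply/seteqP; split => w /=.
  move=> [xw sw] k /andP[sk kt]; case: eqVneq => [->//|ks].
  by apply: xw; rewrite kt andbT ltn_neqAle eq_sym ks.
move=> hw; split; last by rewrite hw ?eqxx// leqnn.
by move=> k /andP[sk kt]; rewrite hw ?gtn_eqF// kt ltnW.
Qed.

(** The Markov property for full histories implies it for histories starting
    at time [s]: the states at earlier times are summed out one after the
    other, and the transition factor does not depend on them. *)
Lemma markov_cylinder s t h : (s <= t)%N ->
  pr (cylinder s t.+1 h) =
  pr (cylinder s t h) * sticky_kernel R (h t) (h t.+1).
Proof.
elim: s h => [|s IH] h st.
  have [_ _ /(_ t h)] := walkA.
  have cyl0 u : [set w | forall k, (k <= u)%N -> A k w = h k] = cylinder 0 u h by [].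
  by rewrite !cyl0 !prE; [case|exact: measurable_cylinder..].
rewrite (pr_total s (measurable_cylinder _ _ _)).
rewrite (pr_total s (measurable_cylinder s.+1 t h)) mulr_suml.
apply: eq_bigr => y _; rewrite !cylinderS; try lia.
have tsF : (t == s) = false by lia.
have tSsF : (t.+1 == s) = false by lia.
by rewrite (IH _ (ltnW st)) tsF tSsF.
Qed.

Definition law t x : R := pr [set w | A t w = x].

Lemma joint_law t x y :
  pr ([set w | A t.+1 w = y] `&` [set w | A t w = x]) =
  law t x * sticky_kernel R x y.
Proof.
pose z k := if k == t then x else y.
have := @markov_cylinder t t z (leqnn t).
rewrite /z eqxx gtn_eqF// => e.
have -> : law t x = pr (cylinder t t z).
  congr pr; apply/seteqP; split => w /=.
    by move=> wx k; rewrite -eqn_leq => /eqP <-; rewrite /z eqxx.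
  by move=> /(_ t); rewrite leqnn /z eqxx; exact.
rewrite -e; congr pr; apply/seteqP; split => w /=.
  move=> [wy wx] k /andP[tk kt]; rewrite /z; case: eqVneq => [->//|kt'].
  by have -> : k = t.+1 by apply/eqP; rewrite eqn_leq kt ltn_neqAle eq_sym kt' tk.
by move=> h; split; rewrite h /z ?eqxx ?gtn_eqF//; lia.
Qed.

(** * Expected drift before absorption *)
Definition walk_mean t f : R := \sum_(x <- states) law t x * f x.

Lemma kernel_mean x f : in_simplex n x ->
  \sum_(y <- states) sticky_kernel R x y * f y = step_mean f x.
Proof.
move=> xn; rewrite /step_mean mulr_sumr.
under eq_bigr do rewrite /sticky_kernel mulr_suml big_mkcondr.
rewrite exchange_big; apply: eq_bigr => j jx.
rewrite (bigD1_seq (sticky_step x j)) ?states_uniq//=; last first.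
  by rewrite mem_states sticky_step_simplex.
rewrite eqxx big1 ?addr0// => y /negbTE; rewrite eq_sym => ->//.
Qed.

Lemma walk_mean_succ t f : walk_mean t.+1 f = walk_mean t (step_mean f).
Proof.
rewrite /walk_mean.
under eq_bigr => y _.
  rewrite /law (pr_total t) ?mulr_suml; last by case: walkA.
  under eq_bigr do rewrite joint_law -mulrA.
  over.
rewrite exchange_big; rewrite [LHS]big_seq [RHS]big_seq.
by apply: eq_bigr => x; rewrite mem_states => xn; rewrite -mulr_sumr kernel_mean.
Qed.

Lemma walk_mean_le t f g : (forall x, in_simplex n x -> f x <= g x) ->
  walk_mean t f <= walk_mean t g.
Proof.
move=> fg; rewrite /walk_mean big_seq [leRHS]big_seq; apply: ler_sum => x.
by rewrite mem_states => /fg; apply: ler_wpM2l; exact: pr_ge0.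
Qed.

Lemma walk_meanD t f g :
  walk_mean t (fun x => f x + g x) = walk_mean t f + walk_mean t g.
Proof. by rewrite -big_split; apply: eq_bigr => x _; rewrite mulrDr. Qed.

Lemma walk_meanZ t a f : walk_mean t (fun x => a * f x) = a * walk_mean t f.
Proof. by rewrite mulr_sumr; apply: eq_bigr => x _; rewrite mulrCA. Qed.

Lemma walk_mean_cst t a : walk_mean t (fun=> a) = a.
Proof.
rewrite /walk_mean -mulr_suml.
have := pr_total t (@measurableT _ T); rewrite /pr probability_setT/= => e.
under eq_bigr do rewrite /law -[X in pr X]setTI.
by rewrite -e mul1r.
Qed.

Definition alive_prob t : R := walk_mean t (fun x => (~~ absorbed x)%:R).

(** A function whose drift is bounded by [D] before absorption, and by 0
    after, grows on average by at most [D] per step before absorption.  The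
    sign of [D] is arbitrary: negative values give upper bounds on the
    duration. *)
Lemma drift_sum f (D : R) N :
  (forall x, in_simplex n x -> step_mean f x - f x <= D * (~~ absorbed x)%:R) ->
  walk_mean N f - walk_mean 0 f <= D * \sum_(0 <= t < N) alive_prob t.
Proof.
move=> fD; rewrite -(telescope_sumr (fun t => walk_mean t f))// mulr_sumr.
apply: ler_sum => t _; rewrite walk_mean_succ -mulN1r -!walk_meanZ -walk_meanD.
by apply: walk_mean_le => x xn; rewrite mulN1r fD.
Qed.

(** [drift_sum] for minus the sum of squares, with [D = - 2]. *)
Lemma alive_sum_le N : (0 < n)%N -> \sum_(0 <= t < N) alive_prob t <= n%:R ^+ 2 / 2.
Proof.
move=> n0.
have h : walk_mean N (fun x => - sqsum R x) - walk_mean 0 (fun x => - sqsum R x) <=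
    - 2 * \sum_(0 <= t < N) alive_prob t.
  apply: drift_sum => x xn; have := sqsum_drift_ge R n0 xn.
  by rewrite /step_mean sumrN mulrN; lra.
have h1 : walk_mean N (fun x => - n%:R ^+ 2) <= walk_mean N (fun x => - sqsum R x).
  by apply: walk_mean_le => x xn; rewrite lerN2 sqsum_le_sqr.
have h2 : walk_mean 0 (fun x => - sqsum R x) <= walk_mean 0 (fun=> 0).
  by apply: walk_mean_le => x _; rewrite oppr_le0 sqsum_ge0.
by rewrite !walk_mean_cst in h1 h2; lra.
Qed.

Lemma walk_mean_sqsum0_le (alpha : R) :
  (forall (w : T) (i : 'I_m), (A 0%N w i)%:R <= alpha * n%:R) ->
  walk_mean 0 (@sqsum R m) <= alpha * n%:R ^+ 2.
Proof.
move=> A0; rewrite -[leRHS](walk_mean_cst 0) /walk_mean.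
rewrite big_seq [leRHS]big_seq; apply: ler_sum => x; rewrite mem_states => xn.
have [/asboolP[w wx]|/asboolP nw] := boolP `[<exists w, A 0%N w = x>].
  apply: ler_wpM2l; first exact: pr_ge0.
  by rewrite expr2 mulrA; apply: sqsum_le => // i; rewrite -wx.
rewrite (_ : law 0 x = 0) ?mul0r//.
rewrite /law (_ : [set w | _] = set0) ?pr_set0//.
by apply/seteqP; split => // w /= wx; apply: nw; exists w.
Qed.

(** The potential starts at [(1 - 4 g) n ^ 2] at most and is equal to
    [((1 - g) ^ 2 - g) n ^ 2] once absorbed, a growth of at least [g n ^ 2].
    At a fixed time [N] the states not yet absorbed lose at most
    [n ^ 2 * alive_prob N] of it.  These probabilities are summable by
    [alive_sum_le], so [N] can be taken for which at most half of the growth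
    is lost. *)
Lemma alive_sum_ge (g alpha : R) : (0 < n)%N -> 0 < g -> g <= 1 ->
  m%:R <= g * n%:R / 2 -> alpha <= 1 - 4 * g ->
  (forall (w : T) (i : 'I_m), (A 0%N w i)%:R <= alpha * n%:R) ->
  exists N, g ^+ 4 / 8 * n%:R ^+ 2 <= \sum_(0 <= t < N) alive_prob t.
Proof.
move=> n0 g0 g1 mg ag A0.
have n0' : 0 < n%:R ^+ 2 :> R by rewrite exprn_gt0// ltr0n.
have [N liveN] : exists N, alive_prob N <= g / 2.
  apply: contrapT => /forallNP lg.
  pose N := Num.bound (n%:R ^+ 2 / g).
  have := alive_sum_le N n0; apply/negP; rewrite -ltNge.
  apply: (@lt_le_trans _ _ (\sum_(0 <= t < N) (g / 2))).
    rewrite sumr_const_nat subn0 -mulr_natl.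
    have := @archi_boundP R (n%:R ^+ 2 / g) (divr_ge0 (ltW n0') (ltW g0)).
    by rewrite -/N ltr_pdivrMr// => ?; lra.
  by apply: ler_sum => t _; rewrite leNgt; apply/negP => /ltW/lg.
exists N.
have h1 : walk_mean N (potential g (g * n%:R)) -
      walk_mean 0 (potential g (g * n%:R)) <=
    4 / g ^+ 3 * \sum_(0 <= t < N) alive_prob t.
  by apply: drift_sum => x xn; exact: potential_drift_le.
have h2 : walk_mean N (fun x => ((1 - g) ^+ 2 - g) * n%:R ^+ 2 +
     - n%:R ^+ 2 * (~~ absorbed x)%:R) <= walk_mean N (potential g (g * n%:R)).
  by apply: walk_mean_le => x xn; rewrite mulNr potential_ge// ltW.
rewrite walk_meanD walk_mean_cst walk_meanZ -/(alive_prob N) in h2.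
have h3 : walk_mean 0 (potential g (g * n%:R)) <= walk_mean 0 (@sqsum R m).
  apply: walk_mean_le => x xn; apply: potential_le_sqsum; first exact: ltW.
  by rewrite mulr_ge0 ?(ltW g0).
have h4 := walk_mean_sqsum0_le A0.
have h5 : g / 2 * n%:R ^+ 2 <= 4 / g ^+ 3 * \sum_(0 <= t < N) alive_prob t.
  apply: le_trans h1; move: (n%:R ^+ 2) n0' h2 h4 => M M0 h2 h4.
  have : alive_prob N * M <= g / 2 * M by rewrite ler_pM2r.
  have : alpha * M <= (1 - 4 * g) * M by rewrite ler_pM2r.
  have : 0 <= g ^+ 2 * M by rewrite mulr_ge0 ?sqr_ge0 ?ltW.
  lra.
rewrite -(ler_pM2l (_ : 0 < 4 / g ^+ 3)) ?divr_gt0 ?exprn_gt0//.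
apply: le_trans h5; rewrite le_eqVlt; apply/orP; left; apply/eqP.
by field; rewrite gt_eqF.
Qed.

(** * From survival probabilities to the mean absorption time *)

Lemma measurable_absorbed t : measurable [set w | absorbed (A t w)].
Proof. exact: (measurable_state t (@absorbed m)). Qed.

Lemma measurable_not_absorbed t : measurable [set w | ~~ absorbed (A t w)].
Proof. exact: (measurable_state t (fun x => ~~ absorbed x)). Qed.

Definition survival t : set T :=
  [set w | forall s, (s <= t)%N -> ~~ absorbed (A s w)].

Lemma measurable_survival t : measurable (survival t).
Proof.
rewrite (_ : survival t =
  \bigcap_(s in [set s | (s <= t)%N]) [set w | ~~ absorbed (A s w)]).
  by apply: bigcap_measurableType => s _; exact: measurable_not_absorbed.
by apply/seteqP; split.
Qed.

Lemma pr_not_absorbed t : pr [set w | ~~ absorbed (A t w)] = alive_prob t.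
Proof.
rewrite (pr_total t) ?/alive_prob; last exact: measurable_not_absorbed.
apply: eq_bigr => x _; case: (boolP (absorbed x)) => xa.
  rewrite mulr0 (_ : _ `&` _ = set0) ?pr_set0//.
  by apply/seteqP; split => // w /= [/[swap] ->]; rewrite xa.
rewrite mulr1; congr pr; apply/seteqP; split => w /=; first by case.
by move=> wx; rewrite wx.
Qed.

Lemma absorbed_forever t :
  pr ([set w | ~~ absorbed (A t.+1 w)] `&` [set w | absorbed (A t w)]) = 0.
Proof.
have mE := measurableI _ _ (measurable_not_absorbed t.+1) (measurable_absorbed t).
rewrite (pr_total t.+1)//; apply: big1 => y _.
rewrite (pr_total t); last by apply: measurableI => //; case: walkA.
apply: big1 => x _; have [e0|] := eqVneq (law t x * sticky_kernel R x y) 0.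
  apply/eqP; rewrite eq_le pr_ge0 andbT -e0 -joint_law.
  apply: pr_le; [| |by move=> w /= [[_ ->] ->]].
  - by apply: measurableI; [apply: measurableI => //|]; case: walkA.
  - by apply: measurableI; case: walkA.
move=> k0; rewrite (_ : _ `&` _ = set0) ?pr_set0//.
apply/seteqP; split => // w /= [[[ya xa] yw] xw].
rewrite yw in ya; rewrite xw in xa.
move/negP : k0; apply; apply/eqP; rewrite /sticky_kernel big1 ?mulr0// => j.
move=> /andP[jx /eqP]; rewrite sticky_step_absorbed// => xy.
by rewrite -xy xa in ya.
Qed.

(** Almost surely an absorbed walk remains so, hence not being absorbed at
    time [t] and never having been absorbed up to [t] have the same
    probability. *)
Lemma pr_survival t : pr (survival t) = alive_prob t.
Proof.
rewrite -pr_not_absorbed; pose B u := [set w | ~~ absorbed (A u w)].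
have mB u : measurable (B u) by exact: measurable_not_absorbed.
have mS := measurable_survival.
have BS u : P (B u `\` survival u) = 0%E.
  elim: u => [|u IH].
    rewrite (_ : _ `\` _ = set0) ?measure0//.
    apply/seteqP; split => // w /= [w0]; apply => s.
    by rewrite leqn0 => /eqP ->.
  have mF : measurable (B u.+1 `&` [set w | absorbed (A u w)]).
    by apply: measurableI => //; exact: measurable_absorbed.
  have mD : measurable (B u `\` survival u) by exact: measurableD.
  apply: (@subset_measure0 _ _ _ _ _ ((B u `\` survival u) `|`
      (B u.+1 `&` [set w | absorbed (A u w)]))) => //.
  - exact: measurableD.
  - exact: measurableU.
  - move=> w [wu nS]; case: (boolP (absorbed (A u w))) => wa; [by right|left].
    split => // Su; apply: nS => s; rewrite leq_eqVlt => /orP[/eqP ->//|].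
    by rewrite ltnS; exact: Su.
  - apply: eq_trans (measureU0 mD mF _) IH.
    by apply: (eq_trans (prE mF)); rewrite absorbed_forever.
have PB : P (B t) = P (B t `&` survival t).
  apply: eq_trans (measureDI P (mB t) (mS t)) _.
  by rewrite [X in (X + _)%E]BS add0e.
rewrite /pr [in RHS]PB; congr (fine (P _)).
apply/seteqP; split => w /=; last by case.
by move=> h; split => //; exact: h.
Qed.

(** Layer-cake formula, valid at every sample point: when absorption never
    happens both sides are infinite.  The series of indicators can be
    integrated term by term. *)
Lemma absorption_timeE w :
  absorption_time R A w = (\sum_(t <oo) (\1_(survival t) w)%:E)%E.
Proof.
have ge0 t : (0 <= (\1_(survival t) w)%:E :> \bar R)%E by rewrite lee_fin.
have surv0 t s : absorbed (A t w) -> (t <= s)%N -> \1_(survival s) w = 0 :> R.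
  move=> wt ts; rewrite indicE memNset// => /(_ t ts); rewrite wt//.
have partial t : (\sum_(0 <= s < t) (\1_(survival s) w)%:E <= (t%:R)%:E :> \bar R)%E.
  rewrite sumEFin lee_fin.
  rewrite (_ : t%:R = \sum_(0 <= s < t) 1 :> R); last first.
    by rewrite sumr_const_nat subn0.
  by apply: ler_sum => s _; rewrite indicE; case: (_ \in _).
apply/eqP; rewrite eq_le; apply/andP; split; last first.
  apply/ereal_infP => _ [t /= wt <-].
  rewrite (nneseries_split 0 t)// eseries0 ?adde0// => s; rewrite add0n => ts _.
  by rewrite (surv0 t).
have sum_surv N : survival N w ->
    ((N%:R)%:E <= \sum_(t <oo) (\1_(survival t) w)%:E :> \bar R)%E.
  move=> SN; apply: le_trans (nneseries_lim_ge N _) => //.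
  rewrite sumEFin lee_fin.
  rewrite (_ : N%:R = \sum_(0 <= s < N) 1 :> R); last first.
    by rewrite sumr_const_nat subn0.
  rewrite !big_nat; apply: ler_sum => s /andP[_ sN]; rewrite indicE mem_set//.
  by move=> k ks; apply: SN; exact: (leq_trans ks (ltnW sN)).
have [ex|nex] := pselect (exists t, absorbed (A t w)).
  pose t := ex_minn ex; have [ta tmin] : absorbed (A t w) /\
     forall s, absorbed (A s w) -> (t <= s)%N by rewrite /t; case: ex_minnP.
  apply: (@le_trans _ _ (t%:R)%:E); first by apply: ereal_inf_lbound; exists t.
  apply: le_trans (nneseries_lim_ge t _) => //.
  rewrite sumEFin lee_fin.
  rewrite (_ : t%:R = \sum_(0 <= s < t) 1 :> R); last first.
    by rewrite sumr_const_nat subn0.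
  rewrite !big_nat; apply: ler_sum => s /andP[_ st]; rewrite indicE mem_set//.
  by move=> k ks; apply/negP => /tmin; rewrite leqNgt (leq_ltn_trans ks).
rewrite (_ : (\sum_(t <oo) _)%E = +oo%E) ?leey//.
apply/eqyP => r r0.
apply: le_trans (sum_surv (Num.bound r) _).
  by rewrite lee_fin ltW// archi_boundP// ltW.
by move=> s _; apply/negP => sa; apply: nex; exists s.
Qed.

Lemma integral_absorption_time :
  (\int[P]_w absorption_time R A w = \sum_(t <oo) (alive_prob t)%:E)%E.
Proof.
under eq_integral do rewrite absorption_timeE.
rewrite integral_nneseries//.
- apply: eq_eseriesr => t _.
  rewrite integral_indic//; last exact: measurable_survival.
  by rewrite setIT -pr_survival; exact: prE (measurable_survival t).
- move=> t; apply/measurable_EFinP; apply: measurable_indic.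
  exact: measurable_survival.
Qed.

Lemma alive_ge0 t : 0 <= alive_prob t.
Proof. by rewrite -pr_not_absorbed pr_ge0. Qed.

End Walk.

Theorem corollary2p4 (R : realType) (alpha : R) (halpha : alpha < 1) :
  exists beta c C : R,
    [/\ 0 < beta, 0 < c & 0 < C] /\
    forall (n m : nat), (0 < n)%N -> (2 <= m)%N -> beta < n%:R / m%:R ->
    forall (d : measure_display) (T : measurableType d) (P : probability T R)
      (A : nat -> T -> {ffun 'I_m -> nat}),
      sticky_walk P n A ->
      (forall (w : T) (i : 'I_m), (A 0%N w i)%:R <= alpha * n%:R) ->
      ((c * n%:R ^+ 2)%:E <= \int[P]_w absorption_time R A w)%E /\
      (\int[P]_w absorption_time R A w <= (C * n%:R ^+ 2)%:E)%E.
Proof.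
(* The growth [(1 - g) ^ 2 - g - alpha] of the potential, in units of [n ^ 2],
   must be at least [g]; this is why [g <= (1 - alpha) / 4]. *)
pose g := Num.min 1 ((1 - alpha) / 4).
have g0 : 0 < g by rewrite lt_min ltr01 divr_gt0// subr_gt0.
have g1 : g <= 1 by rewrite ge_min lexx.
have ag : alpha <= 1 - 4 * g.
  have : g <= (1 - alpha) / 4 by rewrite ge_min lexx orbT.
  by lra.
exists (2 / g), (g ^+ 4 / 8), (1 / 2); split.
  by split; rewrite ?divr_gt0 ?exprn_gt0.
move=> n m n0 m2 nm d T P A walkA A0.
rewrite (integral_absorption_time walkA); split.
  have mg : m%:R <= g * n%:R / 2.
    have m0 : 0 < m%:R :> R by rewrite ltr0n; lia.
    move: nm; rewrite ltr_pdivlMr// mulrAC ltr_pdivrMr// => nm.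
    by rewrite ler_pdivlMr//; lra.
  have [N hN] := alive_sum_ge walkA n0 g0 g1 mg ag A0.
  apply: (@le_trans _ _ (\sum_(0 <= t < N) (alive_prob P n A t)%:E)%E).
    by rewrite sumEFin lee_fin.
  by apply: nneseries_lim_ge => t _ _; rewrite lee_fin alive_ge0.
apply: lime_le.
  by apply: is_cvg_nneseries => t _ _; rewrite lee_fin alive_ge0.
apply: nearW => N; rewrite sumEFin lee_fin mulrC mul1r.
exact: alive_sum_le.
Qed.
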